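(* Let $m\ge 2$ and let $C=\{c_0,\ldots,c_{m-1}\}$ be a set of $m$ odd integers such that $C\equiv\{1,3\}\pmod 4$. Then the set $$\mathcal{N}(C)=\{L\in C^\infty:\ \Lambda(L)\text{ is not a spectrum for the measure }\mu_4\}$$ is either an empty set or an infinite set with full Hausdorff dimension (i.e. Hausdorff dimension $1$).
   Context: $\mu_4$ denotes the middle-fourth Cantor measure: the unique Borel probability measure on $\mathbb{R}$ satisfying $\mu_4(\cdot)=\frac12\mu_4\circ\tau_1^{-1}(\cdot)+\frac12\mu_4\circ\tau_2^{-1}(\cdot)$, where $\tau_1(x)=4^{-1}x$ and $\tau_2(x)=4^{-1}(x+2)$. A discrete set $\Lambda\subseteq\mathbb{R}$ is a spectrum for a Borel probability measure $\mu$ on $\mathbb{R}$ if the family $\{e^{2\pi i\lambda x}:\lambda\in\Lambda\}$ is an orthonormal basis of $L^2(\mu)$. $C\equiv\{1,3\}\pmod 4$ means that the set of residues modulo 4 of the elements of $C$ is $\{1,3\}$ (both residues occur). $C^\infty$ is the set of infinite sequences with entries in $C$. A sequence $L\in C^\infty$ is regarded as a label of the complete infinite binary tree by writing its entries as $$L=a_{1,1}\,a_{2,1}a_{2,3}\,a_{3,1}a_{3,3}a_{3,5}a_{3,7}\cdots,$$ i.e. for $n\ge1$ and odd $k$ with $1\le k\le 2^n-1$, $a_{n,k}$ is the entry of $L$ at position $2^{n-1}+\frac{k-1}{2}$; one also sets $a_{n,k}=0$ for even $k$ with $0\le k\le 2^n-2$. (The numbers $a_{n,0},\ldots,a_{n,2^n-1}$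 label the $n$th level edges of the tree from left to right.) A path is a sequence $(k_n)_{n\ge1}$ with $k_1\in\{0,1\}$ and $k_{n+1}\in\{2k_n,2k_n+1\}$ for all $n\ge 1$ (so $0\le k_n\le 2^n-1$). Define $$\Lambda(L)=\left\{\sum_{i=1}^n 4^{i-1}a_{i,k_i}:\ (k_i)_{i\ge1}\text{ a path},\ n\in\mathbb{N}\right\}.$$ Hausdorff dimension is taken with respect to the metric on $C^\infty$ for which two distinct sequences have distance $m^{-\inf\{n:\ \text{the } n\text{th entries differ}\}}$; the whole space $C^\infty$ then has Hausdorff dimension $1$. *)

(* Defs.v *)
From HB Require Import structures.
From mathcomp Require Import all_boot all_order all_algebra finmap.
From mathcomp Require Import all_classical all_reals all_analysis.
From mathcomp Require Import complex.
Set Implicit Arguments.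
Unset Strict Implicit.
Unset Printing Implicit Defensive.
Import Order.TTheory GRing.Theory Num.Theory.
Import numFieldTopology.Exports numFieldNormedType.Exports.
Local Open Scope classical_set_scope.
Local Open Scope ring_scope.

Section hausdorff_dimension.
Context {R : realType} {T : metricType R}.
Local Open Scope ereal_scope.
Implicit Types A : set T.

(* The supremum over the empty set is -oo, hence the maximum with 0. *)
Definition diam A : \bar R :=
  maxe 0 (ereal_sup [set (mdist p.1 p.2)%:E | p in A `*` A]).

(* The empty set contributes 0 for every s, including s = 0 where 0 `^ 0 = 1;
   this makes the 0-dimensional measure the counting measure. *)
Definition diam_pow (s : R) A : \bar R :=
  if A == set0 then 0 else diam A `^ s.

Definition hausdorff_premeasure (s delta : R) A : \bar R :=
  ereal_inf [set \sum_(0 <= i <oo) diam_pow s (U i) | U in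
    [set U : (set T)^nat |
      A `<=` \bigcup_i U i /\ forall i, diam (U i) <= delta%:E]].

Definition hausdorff_measure (s : R) A : \bar R :=
  ereal_sup [set hausdorff_premeasure s delta A | delta in
    [set delta : R | (0 < delta)%R]].

Definition hausdorff_dim A : \bar R :=
  ereal_inf [set s%:E | s in
    [set s : R | (0 <= s)%R /\ hausdorff_measure s A = 0]].

End hausdorff_dimension.

(* The space C^oo of infinite sequences with entries in C; the real field R only
   serves as the codomain of its distance.  Sequences are indexed from 0, so
   that L n is the entry at position n.+1. *)
Definition infseq (R : realType) (C : {fset int}) : Type := nat -> C.

HB.instance Definition _ (R : realType) (C : {fset int}) :=
  Choice.copy (infseq R C) (nat -> C).

Section infseq_metric.
Context {R : realType} {C : {fset int}}.
Implicit Types L M N : infseq R C.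

Definition infseq_dist L M : R :=
  if pselect (exists n, L n != M n) is left LM
  then (#|` C|%:R) ^- (ex_minn LM).+1 else 0.

Lemma infseq_distxx L : infseq_dist L L = 0.
Proof.
rewrite /infseq_dist; case: pselect => // LL.
by exfalso; case: LL => n; rewrite eqxx.
Qed.

Lemma infseq_base_ge1 L : 1 <= #|` C|%:R :> R.
Proof.
by rewrite ler1n cardfs_gt0; apply/fset0Pn; exists (val (L 0)); exact: valP.
Qed.

Lemma infseq_dist_ge0 L M : 0 <= infseq_dist L M.
Proof. by rewrite /infseq_dist; case: pselect => // LM; rewrite invr_ge0 exprn_ge0. Qed.

Lemma infseq_dist_eq0 L M : infseq_dist L M = 0 -> L = M.
Proof.
rewrite /infseq_dist; case: pselect => [LM /eqP|LM _].
  by rewrite invr_eq0 expf_eq0/= gt_eqF// (lt_le_trans ltr01 (infseq_base_ge1 L)).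
by apply/funext => n; apply: contrapT => /eqP LMn; apply: LM; exists n.
Qed.

Lemma infseq_dist_sym L M : infseq_dist L M = infseq_dist M L.
Proof.
rewrite /infseq_dist; case: pselect => LM; case: pselect => ML //.
- congr (_ ^- _.+1); case: ex_minnP => i Li mi; case: ex_minnP => j Lj mj.
  by apply/eqP; rewrite eqn_leq mi 1?eq_sym// mj// eq_sym.
- by exfalso; apply: ML; case: LM => n; exists n; rewrite eq_sym.
- by exfalso; apply: LM; case: ML => n; exists n; rewrite eq_sym.
Qed.

Lemma infseq_dist_le L M n :
  L n != M n -> (#|` C|%:R) ^- n.+1 <= infseq_dist L M.
Proof.
move=> LMn; have C1 := infseq_base_ge1 L.
rewrite /infseq_dist; case: pselect => [LM|[]]; last by exists n.
case: ex_minnP => i _ /(_ _ LMn) le_in.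
by rewrite lef_pV2 ?posrE ?exprn_gt0 ?(lt_le_trans ltr01)// ler_weXn2l.
Qed.

Lemma infseq_dist_triangle M L N :
  infseq_dist L N <= infseq_dist L M + infseq_dist M N.
Proof.
rewrite {1}/infseq_dist; case: pselect => [LN|_]; last first.
  by rewrite addr_ge0// infseq_dist_ge0.
case: ex_minnP => n LNn _; have [LMn|LMn] := eqVneq (L n) (M n).
  by rewrite (le_trans (@infseq_dist_le M N n _)) -?LMn// lerDr infseq_dist_ge0.
by rewrite (le_trans (infseq_dist_le LMn))// lerDl infseq_dist_ge0.
Qed.

HB.instance Definition _ := @isMetric.Build R (infseq R C) infseq_dist
  infseq_distxx infseq_dist_eq0 infseq_dist_sym infseq_dist_triangle.

End infseq_metric.

Section spectrum.
Context {R : realType}.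
Variable mu : probability (measurableTypeR R) R.
Local Open Scope complex_scope.
Implicit Types (f g : R -> R[i]) (Lambda : set R).

Definition cintegral f : R[i] :=
  (\int[mu]_x complex.Re (f x)) +i* (\int[mu]_x complex.Im (f x)).

Definition L2inner f g : R[i] := cintegral (fun x => f x * conjc (g x)).

Definition L2norm f : \bar R :=
  ('N[mu]_(2%:E)[EFin \o (@ComplexField.Normc.normc R \o f)])%E.

Definition L2fun f : Prop :=
  [/\ measurable_fun [set: measurableTypeR R] (fun x => complex.Re (f x)),
      measurable_fun [set: measurableTypeR R] (fun x => complex.Im (f x)) &
      (L2norm f < +oo)%E].

Definition character (lambda x : R) : R[i] :=
  cos (2 * pi * lambda * x) +i* sin (2 * pi * lambda * x).

Definition orthonormal_characters Lambda : Prop :=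
  forall lambda lambda', Lambda lambda -> Lambda lambda' ->
    L2inner (character lambda) (character lambda') = (lambda == lambda')%:R.

(* The linear span of the characters with frequencies in Lambda is dense in the
   space of square-integrable functions. *)
Definition total_characters Lambda : Prop :=
  forall f, L2fun f -> forall eps : R, 0 < eps ->
    exists2 s : seq (R[i] * R), (forall p, p \in s -> Lambda p.2) &
      (L2norm (fun x => f x - \sum_(p <- s) p.1 * character p.2 x)%R < eps%:E)%E.

Definition is_spectrum Lambda : Prop :=
  [/\ isolated Lambda = Lambda,
      orthonormal_characters Lambda & total_characters Lambda].

End spectrum.

Section middle_fourth_cantor.
Context {R : realType}.

Definition tau1 (x : R) : R := 4^-1 * x.
Definition tau2 (x : R) : R := 4^-1 * (x + 2).

Definition middle_fourth_cantor (mu : probability (measurableTypeR R) R) : Prop :=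
  forall A : set (measurableTypeR R), measurable A ->
    mu A = ((2^-1)%:E * mu (tau1 @^-1` A) + (2^-1)%:E * mu (tau2 @^-1` A))%E.

End middle_fourth_cantor.

Section tree.
Context {R : realType} {C : {fset int}}.
Implicit Type L : infseq R C.

(* The label a_{n,k} (n >= 1, k < 2 ^ n): for odd k it is the entry of L at
   position 2 ^ (n - 1) + (k - 1) / 2, counted from 1; k./2 = (k - 1) / 2. *)
Definition label L (n k : nat) : int :=
  if odd k then val (L (2 ^ n.-1 + k./2).-1) else 0.

(* Paths are indexed from 1; k 0 is irrelevant. *)
Definition is_path (k : nat -> nat) : Prop :=
  k 1%N \in [:: 0; 1]%N /\
  forall n, (1 <= n)%N -> k n.+1 \in [:: (k n).*2; (k n).*2.+1].

Definition tree_frequencies L : set R :=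
  [set lambda | exists k n, [/\ is_path k, (1 <= n)%N &
    lambda = (\sum_(1 <= i < n.+1) 4 ^+ i.-1 * label L i (k i))%:~R]].

End tree.

Definition nonspectral {R : realType} (mu : probability (measurableTypeR R) R)
    (C : {fset int}) : set (infseq R C) :=
  [set L | ~ is_spectrum mu (tree_frequencies L)].
Arguments nonspectral {R} mu C.

(* Main.v *)
From HB Require Import structures.
Require Import Defs.
From mathcomp Require Import all_boot all_order all_algebra finmap.
From mathcomp Require Import all_classical all_reals all_analysis.
From mathcomp Require Import complex measurable_realfun zify ring lra.

(** The theorem rests on one closure property: if the left subtree of a
    labelling [L] (the subtree below the edge labelled [a_{1,0}]) gives a set
    which is not a spectrum, then [L] does not give a spectrum either.  Granted
    this, a single nonspectral [L0] produces many: every [L] whose tree carries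
    [L0] below the leftmost edge of some level is nonspectral, and prescribing
    that subtree at a deep level prescribes only a small proportion of the
    entries of [L], so that what is left free has dimension close to 1.

    Closure ([is_spectrum_left_subtree]).  The frequencies of [L] are the
    numbers [4 * w], with [w] a frequency of the left subtree, together with odd
    integers ([tree_frequencies_split], [tree_frequencies_lift]).  The character
    of frequency [4 * w] pulls back to the character of frequency [w] along both
    branches [tau1] and [tau2], whereas the pullbacks of a character of odd
    frequency along the two branches are opposite.  Since [mu] is the average of
    its images under the branches, inner products of characters are unchanged
    when frequencies are multiplied by 4, which transfers orthonormality.  For
    totality, let [f] be square integrable.  Because [mu] lives on [(-1, 1)]
    ([self_similar_support]), where the branches have disjoint images, there is
    a function [F] with [F \o tau1 = F \o tau2 = f] almost everywhere.  A linear
    combination of characters of [L] pulls back to [P + h] along [tau1] and to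
    [P - h] along [tau2], where [P] uses frequencies of the left subtree only; by
    the parallelogram inequality [P] approximates [f] at least as well as the
    combination approximates [F].

    Dimension.  In heap order the left subtree of [L] is the subsequence
    [L \o left_position], and the iterates of [left_position] grow so fast that
    the image of a high iterate is sparse ([iter_left_position_growth]).  Place
    [L0] along that image and the base-[m] digits of a real [x] of [[0, 1)] at
    the remaining positions.  Two such sequences that agree on their first [p]
    entries come from reals that agree on a number of digits at least [s * p],
    for any [s < 1] fixed beforehand; so the map from [x] to the sequence has a
    Hoelder inverse of exponent [s] ([planted_holder]).  A cover of the
    nonspectral sequences then yields a cover of [[0, 1)] by intervals, and the
    Lebesgue measure of [[0, 1)] prevents the [s]-dimensional measure from
    vanishing ([hausdorff_measure_neq0]).  The converse bound comes from covering
    the whole space by its [m ^ n] cylinders of length [n]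
    ([hausdorff_measure_eq0]). *)

Set Implicit Arguments.
Unset Strict Implicit.
Unset Printing Implicit Defensive.
Import Order.TTheory GRing.Theory Num.Theory.
Import numFieldTopology.Exports numFieldNormedType.Exports.
Local Open Scope classical_set_scope.
Local Open Scope ring_scope.

(** * Self-similarity and the support of the measure *)

Lemma measurable_tau1 {R : realType} :
  @measurable_fun _ _ (measurableTypeR R) (measurableTypeR R) setT tau1.
Proof. exact: measurable_funM. Qed.

Lemma measurable_tau2 {R : realType} :
  @measurable_fun _ _ (measurableTypeR R) (measurableTypeR R) setT tau2.
Proof. by apply: measurable_funM => //; exact: measurable_funD. Qed.

Section self_similar.
Context {R : realType} (mu : probability (measurableTypeR R) R).
Hypothesis mu4 : middle_fourth_cantor mu.
Local Notation MR := (measurableTypeR R).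

Lemma half_nng : (0 <= 2^-1 :> R). Proof. by rewrite invr_ge0. Qed.

(** Self-similarity says that [mu] is the average of its images under the two
    branches, so integrals against it split along the branches. *)
Lemma ge0_integral_self_similar (f : measurableTypeR R -> \bar R) :
  measurable_fun setT f -> (forall x, 0 <= f x)%E ->
  (\int[mu]_x f x = 2^-1%:E * \int[mu]_x f (tau1 x) +
                   2^-1%:E * \int[mu]_x f (tau2 x))%E.
Proof.
move=> mf f0.
pose h : {nonneg R} := NngNum half_nng.
pose m1 : {measure set MR -> \bar R} :=
  mscale h (@pushforward _ _ MR MR R mu tau1).
pose m2 : {measure set MR -> \bar R} :=
  mscale h (@pushforward _ _ MR MR R mu tau2).
rewrite (@eq_measure_integral _ (measurableTypeR R) R setT
  (measure_add (m1 measurable_tau1) (m2 measurable_tau2))); last first.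
  by move=> A mA _; apply: (etrans (mu4 mA)); exact/esym/measure_addE.
rewrite ge0_integral_measure_add// !ge0_integral_mscale//.
by rewrite !ge0_integral_pushforward//;
  (exact: measurable_tau1 || exact: measurable_tau2).
Qed.

Lemma measurable_normr_ge (a : R) :
  measurable ([set x | a <= `|x|] : set (measurableTypeR R)).
Proof.
rewrite [X in measurable X](_ : _ = (@Num.norm R R) @^-1` `[a, +oo[%classic); last first.
  by apply/seteqP; split => x /=; rewrite in_itv/= andbT.
rewrite -[X in measurable X]setTI.
by apply: normr_measurable.
Qed.

(** A point outside [(-2^n, 2^n)] has both of its preimages under the branches
    outside [(-2^n.+1, 2^n.+1)], so the mass outside [(-1, 1)] is at most the mass
    outside [(-2^n, 2^n)] for every [n].  The open interval is what makes the
    images of the two branches, [(-1/4, 1/4)] and [(1/4, 3/4)], disjoint. *)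
Lemma self_similar_support : mu [set x | 1 <= `|x|] = 0%E.
Proof.
pose A n : set (measurableTypeR R) := [set x | 2 ^+ n <= `|x|].
have mA n : measurable (A n) by exact: measurable_normr_ge.
have muA n : (mu (A n) <= mu (A n.+1))%E.
  have p2 : (1 <= 2 ^+ n :> R) by rewrite exprn_ege1// ler1n.
  rewrite mu4//; set B := A n.+1.
  have half x y : (x <= mu B -> y <= mu B ->
      2^-1%:E * x + 2^-1%:E * y <= mu B)%E.
    move=> xB yB; rewrite -[leRHS]mul1e [1%R in leRHS](splitr 1) EFinD.
    by rewrite ge0_muleDl ?lee_fin// !mul1r leeD// lee_wpmul2l// lee_fin half_nng.
  apply: half; apply: le_measure; rewrite ?inE//.
  - rewrite -[X in measurable X]setTI; exact: measurable_tau1.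
  - exact: mA.
  - move=> x; rewrite /B /A /tau1 /preimage/= exprS normrM gtr0_norm ?invr_gt0//.
    by rewrite (mulrC 4^-1) ler_pdivlMr// => h; apply: le_trans h; lra.
  - rewrite -[X in measurable X]setTI; exact: measurable_tau2.
  - exact: mA.
  - move=> x; rewrite /B /A /tau2 /preimage/= exprS normrM gtr0_norm ?invr_gt0//.
    rewrite (mulrC 4^-1) ler_pdivlMr// => h.
    have := ler_normD x 2; rewrite (ger0_norm (_ : 0 <= 2)) //; lra.
have muA0 n : (mu (A 0%N) <= mu (A n))%E.
  by elim: n => // n /le_trans; apply; exact: muA.
have A0 : \bigcap_n A n = set0.
  apply/seteqP; split => // x /(_ (Num.trunc `|x|) I)/=.
  apply/negP; rewrite -ltNge (lt_le_trans (truncnS_gt _))//.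
  by rewrite -natrX ler_nat ltn_expl.
have : (mu \o A) x @[x --> \oo] --> mu (\bigcap_n A n).
  apply: nonincreasing_cvg_mu => //.
  - by rewrite (le_lt_trans (probability_le1 _ _)) ?ltry.
  - by rewrite A0.
  - move=> i j ij; apply/subsetPset => x /=; apply: le_trans.
    by rewrite ler_eXn2l // ltr1n.
rewrite A0 measure0 => cvgA.
apply/eqP; rewrite eq_le measure_ge0 andbT.
rewrite (_ : [set x | 1 <= `|x|] = A 0%N); last by rewrite /A expr0.
rewrite -(cvg_lim _ cvgA)//; apply: lime_ge; first by apply/cvg_ex; exists 0%E.
by near=> n; exact: muA0.
Unshelve. all: by end_near. Qed.

End self_similar.

(** * Characters along the two branches *)

Section characters.
Context {R : realType}.
Implicit Types (lambda x : R) (w : int).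

Lemma cosD2pi_int (a : R) w : cos (a + pi *+ 2 * w%:~R) = cos a.
Proof.
case: w => n.
  by rewrite -pmulrn mulr_natr (periodicn (@cosD2pi R)).
rewrite NegzE mulrNz mulrN -pmulrn mulr_natr.
by rewrite -[LHS](periodicn (@cosD2pi R) n.+1) subrK.
Qed.

Lemma sinD2pi_int (a : R) w : sin (a + pi *+ 2 * w%:~R) = sin a.
Proof.
case: w => n.
  by rewrite -pmulrn mulr_natr (periodicn (@sinD2pi R)).
rewrite NegzE mulrNz mulrN -pmulrn mulr_natr.
by rewrite -[LHS](periodicn (@sinD2pi R) n.+1) subrK.
Qed.

Lemma character_angle (lambda mu x y : R) :
  2 * pi * lambda * x = 2 * pi * mu * y ->
  character lambda x = character mu y.
Proof. by rewrite /character => ->. Qed.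

Lemma character_periodic lambda x k w : lambda * k = w%:~R ->
  character lambda (x + k) = character lambda x.
Proof.
move=> e; rewrite /character.
rewrite (_ : 2 * pi * lambda * (x + k) =
             2 * pi * lambda * x + pi *+ 2 * w%:~R); last by rewrite -e; ring.
by rewrite cosD2pi_int sinD2pi_int.
Qed.

Lemma character_antiperiodic lambda x k w : lambda * k = w%:~R + 2^-1 ->
  character lambda (x + k) = - character lambda x.
Proof.
move=> e; rewrite /character.
rewrite (_ : 2 * pi * lambda * (x + k) =
             (2 * pi * lambda * x + pi) + pi *+ 2 * w%:~R).
  by rewrite cosD2pi_int sinD2pi_int cosDpi sinDpi.
rewrite mulrDr -(mulrA _ lambda k) e; by field.
Qed.

Lemma character_tau1 lambda x : character (4 * lambda) (tau1 x) = character lambda x.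
Proof. by apply: character_angle; rewrite /tau1; field. Qed.

(** The translation by one half is where the parity of the frequencies enters. *)
Lemma tau2_tau1 x : tau2 x = tau1 x + 2^-1 :> R.
Proof. by rewrite /tau1 /tau2; field. Qed.

Lemma character_tau2 w x :
  character (4 * w%:~R) (tau2 x) = character w%:~R x.
Proof.
rewrite tau2_tau1 (@character_periodic _ _ _ (2 * w)) ?character_tau1//.
by rewrite intrM; field.
Qed.

Lemma character_odd_tau2 w x :
  character (2 * w + 1)%:~R (tau2 x) = - character (2 * w + 1)%:~R (tau1 x).
Proof.
rewrite tau2_tau1 (@character_antiperiodic _ _ _ w)//.
by rewrite intrD intrM; field.
Qed.

End characters.

(** * Square norms of complex-valued functions *)

Section complex_valued.
Context {R : realType}.
Local Notation MR := (measurableTypeR R).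
Implicit Types f g : R -> R[i].

(** [R[i]] is not used with a sigma-algebra of its own: square integrability is
    stated through real and imaginary parts. *)
Definition cmeasurable f :=
  measurable_fun [set: MR] (fun x => complex.Re (f x)) /\
  measurable_fun [set: MR] (fun x => complex.Im (f x)).

Definition sqnorm (z : R[i]) : R := complex.Re z ^+ 2 + complex.Im z ^+ 2.

Lemma sqnorm_ge0 z : 0 <= sqnorm z.
Proof. by rewrite addr_ge0// sqr_ge0. Qed.

(** This is what discards the part of a combination that changes sign between
    the branches: replacing [h] by 0 does not increase the average of the two
    errors. *)
Lemma sqnorm_parallelogram (u h : R[i]) :
  2 * sqnorm u <= sqnorm (u - h) + sqnorm (u + h).
Proof.
case: u => a b; case: h => c d; rewrite /sqnorm/=.
by have := sqr_ge0 c; have := sqr_ge0 d; nra.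
Qed.

Lemma measurable_sqnorm f : cmeasurable f ->
  measurable_fun [set: MR] (fun x => (sqnorm (f x))%:E).
Proof.
move=> [mr mi]; apply/measurable_EFinP.
by apply: measurable_funD; apply: measurable_funX.
Qed.

Lemma cmeasurable_comp f (a : MR -> MR) : measurable_fun [set: MR] a ->
  cmeasurable f -> cmeasurable (f \o a).
Proof.
move=> ma [mr mi]; split.
  exact: (measurableT_comp mr ma).
exact: (measurableT_comp mi ma).
Qed.

Lemma cmeasurableB f g : cmeasurable f -> cmeasurable g ->
  cmeasurable (fun x => f x - g x).
Proof.
move=> [fr fi] [gr gi]; split.
  rewrite (_ : (fun x => _) = (fun x => complex.Re (f x)) \- (fun x => complex.Re (g x))).
    exact: measurable_funB.
  by apply/funext => x /=; case: (f x) (g x) => [a b] [c d].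
rewrite (_ : (fun x => _) = (fun x => complex.Im (f x)) \- (fun x => complex.Im (g x))).
  exact: measurable_funB.
by apply/funext => x /=; case: (f x) (g x) => [a b] [c d].
Qed.

Lemma cmeasurableM f g : cmeasurable f -> cmeasurable g ->
  cmeasurable (fun x => f x * g x).
Proof.
move=> [fr fi] [gr gi]; split.
  rewrite (_ : (fun x => _) =
    (fun x => complex.Re (f x) * complex.Re (g x)) \-
    (fun x => complex.Im (f x) * complex.Im (g x))).
    by apply: measurable_funB; apply: measurable_funM.
  by apply/funext => x /=; case: (f x) (g x) => [a b] [c d].
rewrite (_ : (fun x => _) =
    (fun x => complex.Re (f x) * complex.Im (g x)) \+
    (fun x => complex.Im (f x) * complex.Re (g x))).
  by apply: measurable_funD; apply: measurable_funM.
by apply/funext => x /=; case: (f x) (g x) => [a b] [c d].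
Qed.

Lemma cmeasurable_cst (c : R[i]) : cmeasurable (fun=> c).
Proof. by split; exact: measurable_cst. Qed.

Lemma cmeasurable_conj f : cmeasurable f -> cmeasurable (fun x => conjc (f x)).
Proof.
move=> [fr fi]; split.
  rewrite (_ : (fun x => _) = (fun x => complex.Re (f x)))//.
  by apply/funext => x; case: (f x).
rewrite (_ : (fun x => _) = \- (fun x => complex.Im (f x))).
  exact: (measurableT_comp (@oppr_measurable R setT) fi).
by apply/funext => x /=; case: (f x).
Qed.

Lemma cmeasurable_character (lambda : R) : cmeasurable (character lambda).
Proof.
have m : measurable_fun [set: MR] (fun x : MR => 2 * pi * lambda * x).
  by apply: measurable_funM => //; exact: measurable_cst.
split => /=.
  have mc : measurable_fun [set: MR] (@cos R).
    apply: continuous_measurable_fun; exact: continuous_cos.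
  exact: (measurableT_comp mc m).
have mc : measurable_fun [set: MR] (@sin R).
  apply: continuous_measurable_fun; exact: continuous_sin.
exact: (measurableT_comp mc m).
Qed.

Lemma cmeasurable_sum_characters (s : seq (R[i] * R)) :
  cmeasurable (fun x => \sum_(p <- s) p.1 * character p.2 x).
Proof.
elim: s => [|p s ih].
  by under eq_fun do rewrite big_nil; exact: cmeasurable_cst.
under eq_fun do rewrite big_cons -[X in _ + X]opprK.
apply: cmeasurableB.
  by apply: cmeasurableM; [exact: cmeasurable_cst|exact: cmeasurable_character].
under eq_fun do rewrite -sub0r.
by apply: cmeasurableB => //; exact: cmeasurable_cst.
Qed.

Context (mu : probability (measurableTypeR R) R).

Lemma L2normE f :
  L2norm mu f = ((\int[mu]_x (sqnorm (f x))%:E) `^ 2^-1)%E.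
Proof.
rewrite /L2norm unlock; congr (_ `^ _)%E; apply: eq_integral => x _ /=.
rewrite ger0_norm; last by case: (f x) => a b; exact: sqrtr_ge0.
case: (f x) => a b; rewrite powR_mulrn ?sqrtr_ge0//.
by rewrite sqr_sqrtr// addr_ge0// sqr_ge0.
Qed.

Lemma L2norm_lty f :
  (L2norm mu f < +oo)%E = (\int[mu]_x (sqnorm (f x))%:E < +oo)%E.
Proof.
rewrite L2normE; apply/idP/idP => h; last exact: poweR_lty.
by move: h; apply: lty_poweRy; rewrite invr_eq0.
Qed.

Lemma le_L2norm f g :
  (\int[mu]_x (sqnorm (f x))%:E <= \int[mu]_x (sqnorm (g x))%:E)%E ->
  (L2norm mu f <= L2norm mu g)%E.
Proof.
by move=> fg; rewrite !L2normE gt0_ler_poweR// in_itv/= leey andbT;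
  apply: integral_ge0 => x _; rewrite lee_fin sqnorm_ge0.
Qed.

End complex_valued.

(** * Transfer of orthonormality and totality *)

Section spectrum_descent.
Context {R : realType} (mu : probability (measurableTypeR R) R).
Hypothesis mu4 : middle_fourth_cantor mu.
Local Notation MR := (measurableTypeR R).

Lemma half_half (x : \bar R) : (2^-1%:E * x + 2^-1%:E * x = x)%E.
Proof.
rewrite -ge0_muleDl ?lee_fin ?half_nng// -EFinD.
by rewrite (_ : 2^-1 + 2^-1 = 1) ?mul1e//; lra.
Qed.

(** Splitting positive and negative parts makes the identity hold for integrals
    of any sign, integrable or not. *)
Lemma integral_fold (F f : MR -> \bar R) : measurable_fun setT F ->
  (forall x, F (tau1 x) = f x) -> (forall x, F (tau2 x) = f x) ->
  (\int[mu]_x F x = \int[mu]_x f x)%E.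
Proof.
move=> mF F1 F2; rewrite integralE [RHS]integralE.
have F1f : F \o @tau1 R = f by apply/funext.
have F2f : F \o @tau2 R = f by apply/funext.
congr (_ - _)%E.
  rewrite (ge0_integral_self_similar mu4)//; last exact: measurable_funepos.
  rewrite -[LHS]/(2^-1%:E * \int[mu]_x (F^\+ \o @tau1 R) x +
                  2^-1%:E * \int[mu]_x (F^\+ \o @tau2 R) x)%E.
  by rewrite -!funepos_comp F1f F2f half_half.
rewrite (ge0_integral_self_similar mu4)//; last exact: measurable_funeneg.
rewrite -[LHS]/(2^-1%:E * \int[mu]_x (F^\- \o @tau1 R) x +
                2^-1%:E * \int[mu]_x (F^\- \o @tau2 R) x)%E.
by rewrite -!funeneg_comp F1f F2f half_half.
Qed.

Lemma cintegral_fold (F f : R -> R[i]) : cmeasurable F ->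
  (forall x, F (tau1 x) = f x) -> (forall x, F (tau2 x) = f x) ->
  cintegral mu F = cintegral mu f.
Proof.
move=> [mr mi] F1 F2; rewrite /cintegral /Rintegral; congr (fine _ +i* fine _)%C.
  apply: integral_fold => [|x|x]; [|by rewrite F1|by rewrite F2].
    exact: (measurableT_comp (@EFin_measurable R setT) mr).
apply: integral_fold => [|x|x]; [|by rewrite F1|by rewrite F2].
  exact: (measurableT_comp (@EFin_measurable R setT) mi).
Qed.

Lemma L2inner_characters4 (w w' : int) :
  L2inner mu (character (4 * w%:~R)) (character (4 * w'%:~R)) =
  L2inner mu (character w%:~R) (character w'%:~R).
Proof.
apply: cintegral_fold => [|x|x]; [|by rewrite !character_tau1|by rewrite !character_tau2].
by apply: cmeasurableM; last apply: cmeasurable_conj; exact: cmeasurable_character.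
Qed.

(** The two branch images of [(-1, 1)] are separated by the point [1/4], and on
    them [unfold4 f] is [f] composed with the inverse of the branch. *)
Definition unfold4 (f : R -> R[i]) (x : R) : R[i] :=
  if x < 4^-1 then f (4 * x) else f (4 * x - 2).

Lemma unfold4_tau1 f x : x < 1 -> unfold4 f (tau1 x) = f x.
Proof.
move=> x1; rewrite /unfold4 /tau1 ifT; first by congr f; field.
by rewrite gtr_pMr ?invr_gt0.
Qed.

Lemma unfold4_tau2 f x : -1 < x -> unfold4 f (tau2 x) = f x.
Proof.
move=> x1; rewrite /unfold4 /tau2 ifF; first by congr f; field.
by apply/negbTE; rewrite -leNgt ler_pMr ?invr_gt0//; lra.
Qed.

Lemma cmeasurable_unfold4 f : cmeasurable f -> cmeasurable (unfold4 f).
Proof.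
have m1 : @measurable_fun _ _ MR MR setT (fun x : R => 4 * x).
  by apply: measurable_funM => //; exact: measurable_cst.
have m2 : @measurable_fun _ _ MR MR setT (fun x : R => 4 * x - 2).
  by apply: measurable_funB => //; exact: measurable_cst.
have ml : measurable_fun [set: MR] (fun x : R => x < 4^-1).
  by apply: measurable_fun_ltr => //; exact: measurable_cst.
move=> mf; have [r1 i1] := cmeasurable_comp m1 mf.
have [r2 i2] := cmeasurable_comp m2 mf.
split; rewrite /unfold4.
  under eq_fun do rewrite (fun_if (@complex.Re R)).
  exact: measurable_fun_ifT.
under eq_fun do rewrite (fun_if (@complex.Im R)).
exact: measurable_fun_ifT.
Qed.

Lemma ae_unit_interval (P : MR -> Prop) :
  (forall x, -1 < x < 1 -> P x) -> \forall x \ae mu, P x.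
Proof.
move=> h; exists [set x | 1 <= `|x|]; split.
- exact: measurable_normr_ge.
- exact: self_similar_support.
- move=> x /=; apply: contra_notP => /negP; rewrite -ltNge ltr_norml; exact: h.
Qed.

Lemma integral_unfold4 f : cmeasurable f ->
  (\int[mu]_x (sqnorm (unfold4 f x))%:E = \int[mu]_x (sqnorm (f x))%:E)%E.
Proof.
move=> mf; have mF := cmeasurable_unfold4 mf.
have mf2 := measurable_sqnorm mf; have mF2 := measurable_sqnorm mF.
rewrite (ge0_integral_self_similar mu4)//; last first.
  by move=> x; rewrite lee_fin sqnorm_ge0.
rewrite -[RHS]half_half; congr (_ * _ + _ * _)%E; apply: ge0_ae_eq_integral => //.
- exact: (measurableT_comp mF2 measurable_tau1).
- by move=> x _; rewrite lee_fin sqnorm_ge0.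
- by move=> x _; rewrite lee_fin sqnorm_ge0.
- by apply: ae_unit_interval => x /andP[_ x1] _; rewrite unfold4_tau1.
- exact: (measurableT_comp mF2 measurable_tau2).
- by move=> x _; rewrite lee_fin sqnorm_ge0.
- by move=> x _; rewrite lee_fin sqnorm_ge0.
- by apply: ae_unit_interval => x /andP[x1 _] _; rewrite unfold4_tau2.
Qed.

(** The frequencies [4 * w] contribute the same function along both branches and
    the odd ones contribute opposite functions, collected in [h]. *)
Lemma split_characters (Lambda Lambda' : set R) :
  (forall l, Lambda l ->
     (exists2 w : int, Lambda' w%:~R & l = 4 * w%:~R) \/
     exists w : int, l = (2 * w + 1)%:~R) ->
  forall s : seq (R[i] * R), (forall p, p \in s -> Lambda p.2) ->
  exists2 s' : seq (R[i] * R), (forall p, p \in s' -> Lambda' p.2) &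
  exists h : R -> R[i], forall x,
    \sum_(p <- s) p.1 * character p.2 (tau1 x) =
      \sum_(p <- s') p.1 * character p.2 x + h x /\
    \sum_(p <- s) p.1 * character p.2 (tau2 x) =
      \sum_(p <- s') p.1 * character p.2 x - h x.
Proof.
move=> LL'; elim => [_|[c l] s ih ls].
  by exists [::] => //; exists (fun=> 0) => x; rewrite !big_nil subr0 addr0.
have [|s' ls' [h hE]] := ih; first by move=> p ps; apply: ls; rewrite inE ps orbT.
have := LL' _ (ls (c, l) (mem_head _ _)); rewrite /= => -[[w L'w ->]|[w ->]].
  exists ((c, w%:~R) :: s').
    by move=> p; rewrite inE => /predU1P[->//|]; exact: ls'.
  exists h => x; have [e1 e2] := hE x.
  by rewrite !big_cons/= e1 e2 character_tau1 character_tau2 !addrA.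
exists s' => //; exists (fun x => h x + c * character (2 * w + 1)%:~R (tau1 x)) => x.
have [e1 e2] := hE x.
rewrite !big_cons/= e1 e2 character_odd_tau2; split; ring.
Qed.

(** The part [P] of an approximation of [unfold4 f] that is common to both
    branches approximates [f]. *)
Lemma total_characters_descent (Lambda Lambda' : set R) :
  (forall l, Lambda l ->
     (exists2 w : int, Lambda' w%:~R & l = 4 * w%:~R) \/
     exists w : int, l = (2 * w + 1)%:~R) ->
  total_characters mu Lambda -> total_characters mu Lambda'.
Proof.
move=> LL' tot f [fr fi foo] eps eps0.
have mf : cmeasurable f by [].
have [mFr mFi] := cmeasurable_unfold4 mf.
have [|s ls sP] := tot (unfold4 f) _ eps eps0.
  by split => //; rewrite L2norm_lty integral_unfold4// -L2norm_lty.
have [s' ls' [h hE]] := split_characters LL' ls.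
exists s' => //; apply: le_lt_trans sP; apply: le_L2norm.
set G := (X in (_ <= \int[mu]_x (sqnorm (X x))%:E)%E).
have mG : cmeasurable G.
  apply: cmeasurableB; first exact: cmeasurable_unfold4.
  exact: cmeasurable_sum_characters.
have mG2 := measurable_sqnorm mG.
rewrite [leRHS](ge0_integral_self_similar mu4)//; last first.
  by move=> x; rewrite lee_fin sqnorm_ge0.
have mG1' := measurableT_comp mG2 measurable_tau1.
have mG2' := measurableT_comp mG2 measurable_tau2.
have ge0_sqnorm (k : R -> R[i]) (x : R) : (0 <= (sqnorm (k x))%:E :> \bar R)%E.
  by rewrite lee_fin sqnorm_ge0.
rewrite -!ge0_integralZl//; [|exact: lee_fin half_nng..].
have mulge0 (k : R -> R[i]) (x : R) : (0 <= 2^-1%:E * (sqnorm (k x))%:E :> \bar R)%E.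
  by rewrite mule_ge0// lee_fin half_nng.
rewrite -ge0_integralD//; [|exact: measurable_funeM..].
apply: ae_ge0_le_integral => //.
- by move=> x _; exact: (ge0_sqnorm (fun x => f x - _)).
- apply: measurable_sqnorm; exact: cmeasurableB mf (cmeasurable_sum_characters s').
- by move=> x _; rewrite adde_ge0.
- by apply: emeasurable_funD; exact: measurable_funeM.
apply: ae_unit_interval => x /andP[x1 x2] _.
have [e1 e2] := hE x.
rewrite -!EFinM -EFinD lee_fin /G unfold4_tau1// unfold4_tau2// e1 e2.
set P := \sum_(p <- s') _.
rewrite (_ : f x - (P + h x) = f x - P - h x); last by rewrite opprD addrA.
rewrite (_ : f x - (P - h x) = f x - P + h x); last by rewrite opprB addrA addrAC.
by have := sqnorm_parallelogram (f x - P) (h x); lra.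
Qed.

End spectrum_descent.

(** * Left subtrees *)

(** The entries are stored in heap order: numbered from 1, those of level [n.+1]
    have the numbers from [2 ^ n] to [2 ^ n.+1 - 1].  An entry of the left subtree
    keeps its rank within its level but lies one level deeper in the whole tree, so
    its number grows by the size of its level. *)
Definition left_position (p : nat) : nat := (p + 2 ^ trunc_log 2 p.+1)%N.

Section left_subtree.
Context {R : realType} {C : {fset int}}.
Implicit Type L : infseq R C.

Definition left_subtree L : infseq R C := fun p => L (left_position p).

Lemma left_position_level (n j : nat) : (j < 2 ^ n)%N ->
  left_position (2 ^ n + j).-1 = (2 ^ n.+1 + j).-1.
Proof.
move=> jn; rewrite /left_position prednK ?addn_gt0 ?expn_gt0//.
rewrite (@trunc_log_eq 2 n)//; last by rewrite leq_addr expnS mul2n -addnn ltn_add2l.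
have : (0 < 2 ^ n)%N by rewrite expn_gt0.
by rewrite expnS; lia.
Qed.

Lemma label_left_subtree L (n k : nat) : (k < 2 ^ n.+1)%N ->
  label (left_subtree L) n.+1 k = label L n.+2 k.
Proof.
move=> kn; rewrite /label; case: ifP => // _ /=.
rewrite /left_subtree left_position_level//.
by rewrite ltn_half_double -mul2n -expnS.
Qed.

Lemma path_lt k n : is_path k -> (k n.+1 < 2 ^ n.+1)%N.
Proof.
move=> [k1 kS]; elim: n => [|n ih].
  by move: k1; rewrite !inE => /orP[]/eqP->.
have := kS n.+1 isT; rewrite !inE [(2 ^ n.+2)%N]expnS mul2n.
by case/orP => /eqP ->; rewrite ?ltn_double// ltn_Sdouble.
Qed.

Lemma tree_frequencies0 L : tree_frequencies L (0 : R).
Proof.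
exists (fun=> 0%N), 1%N; split => //.
by rewrite big_nat1 /label/= mulr0.
Qed.

Lemma tree_frequencies_int L (l : R) : tree_frequencies L l -> exists w : int, l = w%:~R.
Proof. by move=> [k [n [_ _ ->]]]; eexists. Qed.

(** A path in the left subtree becomes a path in the whole tree by starting with
    the leftmost edge, whose label is 0. *)
Lemma tree_frequencies_lift L (l : R) :
  tree_frequencies (left_subtree L) l -> tree_frequencies L (4 * l).
Proof.
move=> [k [n [[k1 kS] n1 ->]]].
exists (fun i => if (i <= 1)%N then 0%N else k i.-1), n.+1.
have kP : is_path (fun i => if (i <= 1)%N then 0%N else k i.-1).
  split => // -[//|[|i]] _ /=; first exact: k1.
  exact: kS.
split => //; rewrite [in RHS]big_nat_recl//= mulr0 add0r -[4]/(4%:~R) -intrM.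
congr (_%:~R); rewrite mulr_sumr; apply: eq_big_nat => -[//|i] _.
rewrite mulrA -exprS/=; congr (_ * _).
by rewrite [LHS]label_left_subtree//; exact: path_lt.
Qed.

(** The first edge of a path decides: the left one has label 0 and leads into the
    left subtree, the right one has an odd label and everything below it is a
    multiple of 4. *)
Lemma tree_frequencies_split L (l : R) : (forall c : int, c \in C -> (c %% 2)%Z = 1) ->
  tree_frequencies L l ->
  (exists2 w : int, tree_frequencies (left_subtree L) (w%:~R : R) & l = 4 * w%:~R) \/
  exists w : int, l = (2 * w + 1)%:~R.
Proof.
move=> odd_C [k [n [kP + ->]]]; case: n => // n _; have [k1 kS] := kP.
rewrite big_nat_recl//= expr0 mul1r.
have -> : \sum_(1 <= i < n.+1) 4 ^+ i * label L i.+1 (k i.+1) =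
    4 * \sum_(1 <= i < n.+1) 4 ^+ i.-1 * label L i.+1 (k i.+1).
  rewrite mulr_sumr; apply: eq_big_nat => -[//|i] _.
  by rewrite mulrA -exprS.
move: (k1); rewrite !inE => /orP[] /eqP k1E; rewrite k1E.
  left; rewrite /label/= add0r -/(label _ _ _).
  exists (\sum_(1 <= i < n.+1) 4 ^+ i.-1 * label L i.+1 (k i.+1)); last by rewrite intrM.
  case: n => [|n]; first by rewrite big_geq//; exact: tree_frequencies0.
  have k'P : is_path (fun i => k i.+1).
    split; last by move=> i i1; exact: kS.
    by have := kS 1%N isT; rewrite k1E.
  exists (fun i => k i.+1), n.+1; split => //.
  congr (_%:~R); apply: eq_big_nat => -[//|i] _.
  by rewrite label_left_subtree// (path_lt i k'P).
right; rewrite /label/=.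
set c := L _; have := odd_C _ (valP c).
set s := \sum_(_ <= _ < _) _ => oddc.
exists ((val c %/ 2)%Z + 2 * s); congr (_%:~R).
by rewrite [val c in LHS](divz_eq (val c) 2) oddc; ring.
Qed.

Lemma isolated_integers (A : set R) : (forall x, A x -> exists w : int, x = w%:~R) ->
  isolated A = A.
Proof.
move=> AZ; apply/seteqP; split => x; first by move=> [/set_mem].
move=> Ax; split; first exact/mem_set.
exists (ball x 1); first exact: nbhsx_ballx.
apply/seteqP; split => [y [] /=|y ->]; last by split => //; exact: ballxx.
have [w xw] := AZ _ Ax => + /AZ[v yv].
rewrite /ball/= xw yv -intrB -[X in X < _ -> _]intr_norm -[1]/(1%:~R) ltr_int => h.
by congr (_%:~R); lia.
Qed.

Lemma is_spectrum_left_subtree (mu : probability (measurableTypeR R) R) L :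
  middle_fourth_cantor mu -> (forall c : int, c \in C -> (c %% 2)%Z = 1) ->
  is_spectrum mu (tree_frequencies L) ->
  is_spectrum mu (tree_frequencies (left_subtree L)).
Proof.
move=> mu4 odd_C [_ orth tot]; split.
- by apply: isolated_integers => x; exact: tree_frequencies_int.
- move=> l l' Ll Ll'.
  have := orth _ _ (tree_frequencies_lift Ll) (tree_frequencies_lift Ll').
  rewrite (inj_eq (mulfI _)) ?pnatr_eq0//.
  have [w ->] := tree_frequencies_int Ll; have [w' ->] := tree_frequencies_int Ll'.
  by rewrite L2inner_characters4.
- apply: (total_characters_descent mu4 _ tot) => l; exact: tree_frequencies_split.
Qed.

Lemma nonspectral_iter_left (mu : probability (measurableTypeR R) R) L h :
  middle_fourth_cantor mu -> (forall c : int, c \in C -> (c %% 2)%Z = 1) ->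
  nonspectral mu C (iter h left_subtree L) -> nonspectral mu C L.
Proof.
move=> mu4 odd_C; elim: h => //= h ih nL; apply: ih => sL; apply: nL.
exact: is_spectrum_left_subtree.
Qed.

Lemma iter_left_subtree L h p :
  iter h left_subtree L p = L (iter h left_position p).
Proof. by elim: h p => //= h ih p; rewrite {1}/left_subtree ih -iterSr. Qed.

End left_subtree.

Lemma left_position_ltn : {homo left_position : p q / (p < q)%N}.
Proof.
move=> p q pq; rewrite /left_position.
have : (2 ^ trunc_log 2 p.+1 <= 2 ^ trunc_log 2 q.+1)%N.
  by rewrite leq_exp2l// leq_trunc_log// ltnW.
lia.
Qed.

Lemma iter_left_position_inj h : injective (iter h left_position).
Proof.
have inj : injective left_position.
  move=> p q pq; case: (ltngtP p q) => // /left_position_ltn; rewrite pq ltnn//.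
by elim: h => //= h ih p q /inj /ih.
Qed.

(** One step multiplies the number of an entry by at least 3/2, hence two steps by
    at least 2. *)
Lemma iter_left_position_growth j p :
  (2 ^ j * p.+1 <= (iter j.*2 left_position p).+1)%N.
Proof.
have e1 q : (3 * q.+1 < 2 * (left_position q).+1)%N.
  rewrite /left_position; have := trunc_log_ltn q.+1 (isT : (1 < 2)%N).
  by rewrite expnS; lia.
elim: j => [|j ih]; first by rewrite mul1n.
rewrite doubleS !iterS expnS -mulnA.
set r := iter _ _ _ in ih *.
by have := e1 r; have := e1 (left_position r); lia.
Qed.

(** * A lower bound for Hausdorff measures *)

Section hausdorff_lower_bound.
Context {R : realType} {T : metricType R}.
Implicit Types (A U : set T) (s : R).

Lemma diam_ge0 A : (0 <= diam A)%E.
Proof. by rewrite le_max lexx. Qed.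

Lemma diam_pow_ge0 s A : (0 <= diam_pow s A)%E.
Proof. by rewrite /diam_pow; case: ifP => // _; exact: poweR_ge0. Qed.

Lemma mdist_le_diam A x y : A x -> A y -> ((mdist x y)%:E <= diam A)%E.
Proof.
move=> Ax Ay; rewrite le_max; apply/orP; right.
by apply: ereal_sup_ubound; exists (x, y).
Qed.

Lemma hausdorff_measure_ge0 s A : (0 <= hausdorff_measure s A)%E.
Proof.
apply: (@le_trans _ _ (hausdorff_premeasure s 1 A)); last first.
  by apply: ereal_sup_ubound; exists 1 => //=.
by apply/ereal_infP => _ [U _ <-]; apply: nneseries_ge0 => i _ _; exact: diam_pow_ge0.
Qed.

(** If the inverse of [phi] is Hoelder of exponent [s], then a set of diameter [d]
    has its preimage in an interval of length [2 * K * d `^ s]; a cover of [A]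
    therefore cannot be cheaper than [1 / (2 * K)], as the intervals cover
    [[0, 1)].  The form of the hypothesis makes sense for [s = 0] too, where
    [0 `^ 0 = 1] as in [diam_pow]. *)
Lemma hausdorff_measure_neq0 A (phi : R -> T) (K s : R) : 0 <= s -> 0 < K ->
  (forall x, 0 <= x < 1 -> A (phi x)) ->
  (forall x y, 0 <= x < 1 -> 0 <= y < 1 ->
    `|x - y| <= K * mdist (phi x) (phi y) `^ s) ->
  hausdorff_measure s A != 0%E.
Proof.
move=> s0 K0 Aphi holder; rewrite gt_eqF//.
apply: (@lt_le_trans _ _ (hausdorff_premeasure s 1 A)); last first.
  by apply: ereal_sup_ubound; exists 1 => //=.
apply: (@lt_le_trans _ _ ((K *+ 2)^-1)%:E).
  by rewrite lte_fin invr_gt0 mulrn_wgt0.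
apply/ereal_infP => _ [U [AU dU] <-].
pose d i := fine (diam (U i)).
have dE i : diam (U i) = (d i)%:E.
  by rewrite fineK// ge0_fin_numE ?diam_ge0// (le_lt_trans (dU i)) ?ltry.
pose meets i := exists2 x, 0 <= x < 1 & U i (phi x).
have cover i : exists B : set R, [/\ measurable (B : set (measurableTypeR R)),
    (lebesgue_measure B <= (K *+ 2)%:E * diam_pow s (U i))%E &
    forall x, 0 <= x < 1 -> U i (phi x) -> B x].
  have [[x x01 Ux]|noU] := pselect (meets i); last first.
    exists set0; split => //.
      by rewrite measure0 mule_ge0 ?diam_pow_ge0// lee_fin mulrn_wge0// ltW.
    by move=> x x01 Ux; apply: noU; exists x.
  pose r := K * d i `^ s.
  have r0 : 0 <= r by rewrite mulr_ge0 ?powR_ge0// ltW.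
  exists `[x - r, x + r]%classic; split => //.
    rewrite lebesgue_measure_itv/= /diam_pow.
    case: eqP => [U0|_]; first by rewrite U0 in Ux.
    rewrite dE poweR_EFin -EFinM; case: ifP => _; rewrite lee_fin.
      rewrite /r; lra.
    by rewrite mulr_ge0 ?powR_ge0// mulrn_wge0// ltW.
  move=> y y01 Uy /=; rewrite in_itv/=.
  have xyr : `|x - y| <= r.
    apply: (le_trans (holder _ _ x01 y01)); rewrite ler_pM2l//.
    apply: ge0_ler_powR => //; rewrite ?nnegrE ?mdist_ge0//.
      by rewrite -lee_fin -dE diam_ge0.
    by rewrite -lee_fin -dE mdist_le_diam.
  by move: xyr; rewrite ler_norml; lra.
have [B BP] := choice cover.
have : (lebesgue_measure (`[0%R, 1%R[%classic : set R) <=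
    \sum_(0 <= i <oo) lebesgue_measure (B i))%E.
  apply: measure_sigma_subadditive.
  - by move=> i; have [] := BP i.
  - exact: measurable_itv.
  - move=> x /=; rewrite in_itv/= => x01.
    have [i _ Ui] := AU _ (Aphi _ x01).
    by exists i => //; have [_ _ Bi] := BP i; exact: Bi.
rewrite lebesgue_measure_itv/= lte_fin ltr01 -EFinB subr0 => le1.
have : (1%:E <= (K *+ 2)%:E * \sum_(0 <= i <oo) diam_pow s (U i))%E.
  rewrite -nneseriesZl; last by move=> i _; exact: diam_pow_ge0.
  apply: (le_trans le1); apply: lee_nneseries => // i _.
  by have [] := BP i.
rewrite -lee_pdivrMl ?mule1//; exact: mulrn_wgt0.
Qed.

End hausdorff_lower_bound.

(** * Hausdorff measures of sets of sequences *)

Section sequence_space.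
Context {R : realType} {C : {fset int}}.
Hypothesis C2 : (2 <= #|` C|)%N.
Local Notation b := (#|` C|%:R : R).
Implicit Types L M : infseq R C.

Lemma base_gt1 : 1 < b. Proof. by rewrite ltr1n. Qed.

Lemma base_gt0 : 0 < b. Proof. exact: lt_trans base_gt1. Qed.

Lemma base_expV_lt (eta : R) : 0 < eta -> exists n, b ^- n.+1 < eta.
Proof.
move=> eta0; exists (Num.trunc eta^-1).
rewrite invf_plt ?posrE ?exprn_gt0 ?base_gt0//.
apply: (lt_trans (truncnS_gt _)); rewrite -natrX ltr_nat.
exact: ltn_expl.
Qed.

Lemma infseq_dist_first L M n : L n != M n ->
  (forall j, (j < n)%N -> L j = M j) -> mdist L M = b ^- n.+1.
Proof.
move=> LMn agree; rewrite /mdist/= /infseq_dist.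
case: pselect => [LM|[]]; last by exists n.
case: ex_minnP => i LMi imin; suff -> : i = n by [].
apply/eqP; rewrite eqn_leq imin//= leqNgt; apply/negP => /agree.
by move/eqP; rewrite (negbTE LMi).
Qed.

Lemma infseq_dist_agree L M n :
  (forall j, (j < n)%N -> L j = M j) -> mdist L M <= b ^- n.+1.
Proof.
move=> agree; rewrite /mdist/= /infseq_dist; case: pselect => [LM|_]; last first.
  by rewrite invr_ge0 exprn_ge0// ltW// base_gt0.
case: ex_minnP => i LMi _.
rewrite lef_pV2 ?posrE ?exprn_gt0 ?base_gt0//.
rewrite ler_weXn2l ?ltW ?base_gt1// ltnS leqNgt; apply/negP => /agree.
by move/eqP; rewrite (negbTE LMi).
Qed.

(** The [b ^ n] cylinders of length [n] have diameter at most [r = b ^- n.+1], and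
    [b ^ n * r `^ s <= r `^ (s - 1)] tends to 0 as [n] grows. *)
Lemma hausdorff_measure_eq0 (A : set (infseq R C)) (s : R) : 1 < s ->
  hausdorff_measure s A = 0%E.
Proof.
move=> s1; apply/eqP; rewrite eq_le hausdorff_measure_ge0 andbT.
apply/ereal_supP => _ [delta /= delta0 <-].
apply/lee_addgt0Pr => eps eps0; rewrite add0e.
pose t := s - 1; have t0 : 0 < t by rewrite subr_gt0.
have [n] : exists n, b ^- n.+1 < Num.min delta (eps `^ t^-1).
  by apply: base_expV_lt; rewrite lt_min delta0 powR_gt0.
set r := b ^- n.+1; rewrite lt_min => /andP[rdelta reps].
have r0 : 0 < r by rewrite invr_gt0 exprn_gt0// base_gt0.
pose word L : {ffun 'I_n -> C} := [ffun j : 'I_n => L j].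
pose U (i : nat) : set (infseq R C) := [set L | enum_rank (word L) = i :> nat].
have diamU i : (diam (U i) <= r%:E)%E.
  rewrite ge_max lee_fin (ltW r0)/=; apply/ereal_supP => _ [[L M] [/= UL UM] <-].
  rewrite lee_fin infseq_dist_agree// => j jn.
  have /enum_rank_inj/ffunP/(_ (Ordinal jn)) : enum_rank (word L) = enum_rank (word M).
    by apply: val_inj; rewrite /= UL UM.
  by rewrite !ffunE.
apply: ge_ereal_inf; exists (\sum_(0 <= i <oo) diam_pow s (U i))%E.
  exists U => //; split => [L _|i].
    by exists (enum_rank (word L)).
  by apply: (le_trans (diamU i)); rewrite lee_fin ltW.
pose N := #|{: {ffun 'I_n -> C}}|.
have U0 i : (N <= i)%N -> diam_pow s (U i) = 0%E.
  move=> Ni; rewrite /diam_pow ifT//; apply/eqP/seteqP; split => // L /= UL.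
  by have := ltn_ord (enum_rank (word L)); rewrite UL ltnNge Ni.
rewrite (nneseries_split 0 N); last by move=> i _; exact: diam_pow_ge0.
rewrite add0n [X in (_ + X)%E]eseries0 ?adde0; last by move=> i Ni _; exact: U0.
have powU i : (diam_pow s (U i) <= (r `^ s)%:E)%E.
  rewrite /diam_pow; case: ifP => _; first by rewrite lee_fin powR_ge0.
  rewrite -poweR_EFin gt0_ler_poweR ?(le_trans _ (ltW s1))//.
  - by rewrite in_itv/= leey diam_ge0.
  - by rewrite in_itv/= leey lee_fin ltW.
apply: (@le_trans _ _ (\sum_(0 <= i < N) (r `^ s)%:E)%E); first exact: lee_sum.
rewrite sumEFin lee_fin sumr_const_nat subn0.
have -> : r `^ s = r `^ t * r.
  rewrite -[X in _ * X](powRr1 (ltW r0)) -powRD ?subrK//.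
  by rewrite (gt_eqF r0) implybT.
rewrite -mulr_natr -mulrA.
have Nr : r * N%:R <= 1.
  rewrite /r /N card_ffun card_ord -cardfE natrX exprS invfM -mulrA.
  rewrite mulVf ?mulr1; last by rewrite expf_neq0// gt_eqF// base_gt0.
  by rewrite invf_le1 ?base_gt0// ltW// base_gt1.
apply: (@le_trans _ _ (r `^ t)); first by rewrite ler_piMr// powR_ge0.
have -> : eps = (eps `^ t^-1) `^ t.
  by rewrite -powRrM mulVf ?gt_eqF// powRr1// ltW.
by rewrite ge0_ler_powR ?nnegrE ?powR_ge0// ltW.
Qed.

End sequence_space.

(** * Planting a sequence among the digits of a real number *)

Section digits.
Context {R : realType} (b : nat).
Hypothesis b0 : (0 < b)%N.
Implicit Type x : R.

Definition digit (j : nat) x : nat := Num.trunc (b%:R ^+ j.+1 * x) %% b.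

Lemma trunc_mul_div x : 0 <= x -> (Num.trunc (b%:R * x) %/ b)%N = Num.trunc x.
Proof.
move=> x0; apply/esym/truncn_def.
have bx0 : 0 <= b%:R * x by rewrite mulr_ge0.
have /andP[lo hi] := truncn_itv bx0.
have bR : 0 < b%:R :> R by rewrite ltr0n.
apply/andP; split.
  rewrite -(ler_pM2l bR) (le_trans _ lo)// -natrM ler_nat mulnC.
  exact: leq_divM.
rewrite -(ltr_pM2l bR) (lt_le_trans hi)// -natrM ler_nat mulnC.
by rewrite ltn_ceil.
Qed.

(** Equal digits up to rank [f] force equal integer parts after multiplication by
    [b ^ f]. *)
Lemma digits_close f x y : 0 <= x < 1 -> 0 <= y < 1 ->
  (forall j, (j < f)%N -> digit j x = digit j y) -> `|x - y| <= b%:R ^- f.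
Proof.
move=> /andP[x0 x1] /andP[y0 y1] dxy.
have bR : 0 < b%:R :> R by rewrite ltr0n.
have trE : Num.trunc (b%:R ^+ f * x) = Num.trunc (b%:R ^+ f * y).
  elim: f dxy => [|f ih] dxy.
    by rewrite !mul1r; rewrite (@truncn_def _ x 0) ?(@truncn_def _ y 0) ?x0 ?y0.
  rewrite (divn_eq (Num.trunc (_ * x)) b) (divn_eq (Num.trunc (_ * y)) b).
  rewrite -/(digit f x) -/(digit f y) dxy// exprS -!mulrA.
  rewrite !trunc_mul_div ?mulr_ge0 ?exprn_ge0//.
  by rewrite ih// => j jf; apply: dxy; exact: ltnW.
have bf0 : 0 < b%:R ^+ f :> R by rewrite exprn_gt0.
have := truncn_itv (mulr_ge0 (ltW bf0) x0); rewrite trE => /andP[xl xu].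
have := truncn_itv (mulr_ge0 (ltW bf0) y0) => /andP[yl yu].
rewrite -[b%:R ^- f]mul1r ler_pdivlMr// -[X in _ * X](gtr0_norm bf0) -normrM.
by rewrite mulrBl ler_norml !(mulrC _ (b%:R ^+ f)) -natr1 in xu yu *; lra.
Qed.

End digits.

Section planting.
Context {T : eqType} (e : nat -> nat) (old new : nat -> T).
(** When [p <= e p] holds throughout, a position [p] in the range of [e] is the
    image of some argument at most [p]. *)
Definition prefix_images (p : nat) : seq nat := map e (iota 0 p.+1).

Definition is_free (p : nat) : bool := p \notin prefix_images p.

Definition free_count (p : nat) : nat := count is_free (iota 0 p).

(** [old] is written along the range of [e], and [new] fills the other positions
    in order. *)
Definition plant (p : nat) : T :=
  if is_free p then new (free_count p) else old (index p (prefix_images p)).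

Lemma free_countS p : free_count p.+1 = (free_count p + is_free p)%N.
Proof. by rewrite /free_count -[p.+1]addn1 iotaD count_cat/= addn0. Qed.

Lemma plant_image p : injective e -> (p <= e p)%N -> plant (e p) = old p.
Proof.
move=> e_inj pe; have pin : e p \in prefix_images (e p).
  by rewrite /prefix_images mem_map// mem_iota add0n ltnS.
rewrite /plant ifF; last by rewrite /is_free pin.
rewrite /prefix_images index_map//.
have pE : nth 0%N (iota 0 (e p).+1) p = p by rewrite nth_iota ?ltnS.
by rewrite -[X in index X _]pE index_uniq ?size_iota ?ltnS// iota_uniq.
Qed.

(** A nonfree position below [p] is the image of some [r] with [M * r.+1 <= p]. *)
Lemma free_count_ge M p : (0 < M)%N -> (forall q, (M * q.+1 <= (e q).+1)%N) ->
  (p <= free_count p + p %/ M)%N.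
Proof.
move=> M0 growth; rewrite -[leqLHS](size_iota 0) -(count_predC is_free) leq_add2l.
rewrite -size_filter -(size_iota 0 (p %/ M)) -(size_map e (iota 0 (p %/ M))).
apply: uniq_leq_size => [|q]; first by rewrite filter_uniq// iota_uniq.
rewrite mem_filter/= negbK mem_iota add0n/= => /andP[/mapP[r _ ->] lt_er].
rewrite map_f// mem_iota add0n/= leq_divRL// mulnC.
exact: leq_trans (growth r) lt_er.
Qed.

End planting.

Lemma plant_agree {T : eqType} (e : nat -> nat) (old new new' : nat -> T) p :
  (forall q, (q < p)%N -> plant e old new q = plant e old new' q) ->
  forall j, (j < free_count e p)%N -> new j = new' j.
Proof.
elim: p => [//|p ih] agree j; rewrite free_countS.
have [fp|nfp] := boolP (is_free e p); last first.
  by rewrite addn0; apply: ih => q qp; apply: agree; exact: ltnW.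
rewrite addn1 ltnS leq_eqVlt => /predU1P[->|].
  by have := agree p (ltnSn p); rewrite /plant fp.
by apply: ih => q qp; apply: agree; exact: ltnW.
Qed.

Section planted_family.
Context {R : realType} {C : {fset int}}.
Hypothesis C2 : (2 <= #|` C|)%N.
Local Notation m := (#|` C|).
Variables (L0 : infseq R C) (e : nat -> nat) (M : nat).
Hypothesis growth : forall q, (M * q.+1 <= (e q).+1)%N.
Hypothesis M2 : (2 <= M)%N.

Definition digit_entry (x : R) (j : nat) : C := nth (L0 0%N) (enum {: C}) (digit m j x).

Definition planted (x : R) : infseq R C := plant e L0 (digit_entry x).

Lemma digit_entry_inj x y j : digit_entry x j = digit_entry y j ->
  digit m j x = digit m j y.
Proof.
have m0 : (0 < m)%N by exact: ltnW.
have lt_digit z : (digit m j z < size (enum {: C}))%N.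
  by rewrite -cardE cardT -cardE -cardfE ltn_mod.
by move=> /eqP; rewrite nth_uniq ?enum_uniq// => /eqP.
Qed.

Lemma planted_image x p : injective e -> planted x (e p) = L0 p.
Proof.
move=> e_inj; apply: plant_image => //; rewrite -ltnS (leq_trans _ (growth p))//.
by rewrite leq_pmull// ltnW.
Qed.

Lemma planted_close x y p : 0 <= x < 1 -> 0 <= y < 1 ->
  (forall q, (q < p)%N -> planted x q = planted y q) ->
  `|x - y| <= m%:R ^- free_count e p.
Proof.
move=> x01 y01 agree; apply: digits_close => //; first exact: ltnW.
by move=> j jp; apply: digit_entry_inj; apply: plant_agree agree _ jp.
Qed.

(** Injectivity is separate from the Hoelder bound, which needs a first position
    where the two sequences differ: equal sequences have all digits in common. *)
Lemma planted_inj x y : 0 <= x < 1 -> 0 <= y < 1 ->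
  planted x = planted y -> x = y.
Proof.
move=> x01 y01 xy; apply/eqP; rewrite -subr_eq0 -normr_eq0.
rewrite eq_le normr_ge0 andbT leNgt; apply/negP => pos.
have [n] := base_expV_lt C2 pos.
apply/negP; rewrite -leNgt.
apply: (le_trans (@planted_close x y n.+1.*2 x01 y01 _)); first by rewrite xy.
rewrite lef_pV2 ?posrE ?exprn_gt0 ?base_gt0// ler_weXn2l ?ltW ?base_gt1//.
have := free_count_ge n.+1.*2 (ltnW M2) growth.
have : (n.+1.*2 %/ M <= n.+1)%N.
  rewrite -ltnS ltn_divLR ?(ltnW M2)// (leq_trans (_ : _ < n.+2 * 2)%N) ?leq_mul2l ?M2 ?orbT//.
  by rewrite muln2 ltn_double.
lia.
Qed.

(* The density of the range of [e] is at most [1 / M], so the free positions have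
   density at least [s]. *)
Variable s : R.
Hypothesis Ms : 1 <= M%:R * (1 - s).

Lemma free_count_geR p : s * p%:R <= (free_count e p)%:R.
Proof.
have M0 : (0 < M)%N by exact: ltnW.
have MR : 0 < M%:R :> R by rewrite ltr0n.
have le1 := free_count_ge p M0 growth.
have : (M * p <= M * free_count e p + p)%N.
  rewrite (leq_trans (leq_mul (leqnn M) le1))// mulnDr leq_add2l mulnC.
  exact: leq_divM.
rewrite -(ler_nat R) natrD !natrM => le2.
rewrite -(ler_pM2l MR).
have : p%:R <= M%:R * (1 - s) * p%:R by rewrite ler_peMl.
by lra.
Qed.

(** With [p] the first position where the sequences differ, their distance is
    [m ^- p.+1], and the reals share [free_count e p >= s * p] digits; the constant
    [m] absorbs the shift from [p] to [p.+1]. *)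
Lemma planted_holder x y : 0 <= x < 1 -> 0 <= y < 1 ->
  `|x - y| <= m%:R * mdist (planted x) (planted y) `^ s.
Proof.
move=> x01 y01; have [->|xy] := eqVneq x y.
  by rewrite subrr normr0 mulr_ge0 ?powR_ge0.
have ex_diff : exists p, planted x p != planted y p.
  apply: contrapT => agree; move/eqP: xy; apply.
  apply: planted_inj => //; apply/funext => p; apply: contrapT => /eqP xyp.
  by apply: agree; exists p.
have [p xyp minp] := ex_minnP ex_diff.
have agree q : (q < p)%N -> planted x q = planted y q.
  by move=> qp; apply/eqP; apply: contraTT qp => /minp; rewrite -leqNgt.
rewrite (infseq_dist_first xyp agree); apply: (le_trans (planted_close x01 y01 agree)).
have b1 : 1 <= m%:R :> R by rewrite ler1n ltnW.
rewrite -!powR_invn ?(le_trans ler01)// -powRrM.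
rewrite -[X in _ <= X * _](powRr1 (le_trans ler01 b1)) -powRD; last first.
  by rewrite (gt_eqF (lt_le_trans ltr01 b1)) implybT.
apply: ler_powR => //; rewrite mulNr -subr_ge0.
have s1 : s <= 1.
  have M0 : 0 < M%:R :> R by rewrite ltr0n ltnW.
  by rewrite -subr_ge0 -(pmulr_rge0 _ M0) (le_trans ler01).
have := free_count_geR p.
by rewrite -(natr1 p); lra.
Qed.

End planted_family.

(** * The dichotomy *)

Theorem theorem1p4 (R : realType) (mu4 : probability (measurableTypeR R) R)
  (hmu4 : middle_fourth_cantor mu4)
  (m : nat) (hm : (2 <= m)%N) (C : {fset int}) (hCm : #|` C|%fset = m)
  (hCodd : forall c : int, c \in C -> (c %% 2)%Z = 1)
  (hC : [fset (c %% 4)%Z | c in C]%fset = [fset 1; 3]%fset) :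
  nonspectral mu4 C = set0 \/
  (infinite_set (nonspectral mu4 C) /\ hausdorff_dim (nonspectral mu4 C) = 1%E).
Proof.
have C2 : (2 <= #|` C|)%N by rewrite hCm.
have [->|/set0P[L0 L0ns]] := eqVneq (nonspectral mu4 C) set0; [by left|right].
have plant_family (s : R) : s < 1 -> exists phi : R -> infseq R C,
    [/\ forall x, nonspectral mu4 C (phi x),
      forall x y, 0 <= x < 1 -> 0 <= y < 1 -> phi x = phi y -> x = y &
      forall x y, 0 <= x < 1 -> 0 <= y < 1 ->
        `|x - y| <= #|` C|%:R * mdist (phi x) (phi y) `^ s].
  move=> s1; have s1' : 0 < 1 - s by rewrite subr_gt0.
  (* Planting below level [2 * j] leaves a density [1 - 2 ^- j >= s] free. *)
  pose j := (Num.trunc (1 - s)^-1).+1.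
  have Ms : 1 <= (2 ^ j)%:R * (1 - s) :> R.
    rewrite -ler_pdivrMr// mul1r (le_trans (ltW (truncnS_gt _)))// ler_nat.
    by rewrite ltnW// ltn_expl.
  have M2 : (2 <= 2 ^ j)%N by rewrite expnS leq_pmulr// expn_gt0.
  pose e := iter j.*2 left_position.
  have e_inj : injective e := @iter_left_position_inj _.
  have growth q : (2 ^ j * q.+1 <= (e q).+1)%N := iter_left_position_growth j q.
  exists (planted L0 e); split => [x|x y|x y x01 y01].
  - apply: (@nonspectral_iter_left _ _ _ _ j.*2) => //.
    suff -> : iter j.*2 left_subtree (planted L0 e x) = L0 by [].
    by apply/funext => p; rewrite iter_left_subtree (planted_image L0 growth M2).
  - exact: (planted_inj C2 growth M2).
  - exact: (planted_holder C2 L0 growth M2 Ms).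
split.
  have [phi [phiN phi_inj _]] := plant_family 0 ltr01.
  have unit01 n : 0 <= (n.+2%:R^-1 : R) < 1.
    by rewrite invr_ge0 ler0n/= invf_lt1 ?ltr1n// ltr0n.
  move=> finN; apply: infinite_nat.
  rewrite (_ : setT = (fun n : nat => phi n.+2%:R^-1) @^-1` nonspectral mu4 C).
    apply: finite_preimage finN => p q _ _ /phi_inj.
    by move=> /(_ (unit01 p) (unit01 q))/invr_inj/eqP; rewrite eqr_nat => /eqP[].
  by apply/seteqP; split => // n _; exact: phiN.
apply/eqP; rewrite eq_le; apply/andP; split.
  apply/lee_addgt0Pr => eps eps0; apply: ereal_inf_lbound.
  exists (1 + eps); rewrite ?EFinD//=; split; first by rewrite addr_ge0// ltW.
  by apply: hausdorff_measure_eq0; rewrite // ltrDl.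
apply/ereal_infP => _ [s [/= s0 Hs] <-]; rewrite lee_fin leNgt; apply/negP => s1.
have [phi [phiN _ phiH]] := plant_family s s1.
have K0 : 0 < #|` C|%:R :> R by exact: base_gt0.
have := hausdorff_measure_neq0 s0 K0 (fun x _ => phiN x) phiH.
by rewrite Hs eqxx.
Qed.
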